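(* Consider Halpern's iteration $x^n=(1-\beta_n)y^0+\beta_nTx^{n-1}$ for an arbitrary sequence $\beta_n\in[0,1]$, i.e. the averaging sequence $\pi^n=(1-\beta_n)\delta^0+\beta_n\delta^n$. Then the three optimization strategies $(\mathrm{FH}_n)$, $(\mathrm{S}_n)$ and $(\mathrm{MS}_n)$ (restricted to such averaging sequences) have the same optimal solution. More explicitly: (a) the optimal $\beta_n$'s are given recursively by $\hat\beta_{n+1}=\frac12(1+\hat\beta_n^2)$ with $\hat\beta_0=0$; (b) the sequence $\hat\beta_n$ is increasing and the corresponding optimal bounds $\hat R_n$ satisfy the recursion $\hat R_{n+1}=\hat R_n-\frac14\hat R_n^2$; (c) the bounds $\hat R_n$ are tight: there is a non-expansive map $\hat T:C\to C$, with $C$ a convex subset of a normed space with $\operatorname{diam}(C)=1$, and a corresponding Halpern sequence (with $\beta_n=\hat\beta_n$) such that $\|x^n-\hat Tx^n\|=\hat R_n$ for all $n\in\mathbb{N}$; (d) the bounds satisfy $\hat R_n\le\frac{4}{n+4}$, with $\lim_{n\to\infty}(n+4)\hat R_n=4$.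
   Context: $\mathbb{N}=\{0,1,2,\ldots\}$; $\delta^k$ denotes the Dirac mass at $k\in\mathbb{N}$, so $\pi^n$ is a probability distribution on $\{0,\ldots,n\}$ with $\pi^n_0=1-\beta_n$, $\pi^n_n=\beta_n$ for $n\ge1$, other entries zero, and $\pi^0=\delta^0$ (with $\beta_0=0$). A map $T:C\to C$ is non-expansive if $\|Tx-Ty\|\le\|x-y\|$ for all $x,y\in C$. A Halpern sequence of $T$ is a sequence with $x^n=(1-\beta_n)y^0+\beta_nTx^{n-1}$ for all $n\ge1$, started from initial points $x^0,y^0\in C$. Bounds. For a sequence $\pi=(\pi^n)_n$ of probability vectors with $\pi^n$ supported in $\{0,\ldots,n\}$, define $d_{m,n}$ for integers $m,n\ge-1$ by $d_{-1,-1}=0$, $d_{-1,j}=d_{j,-1}=1$ for $j\in\mathbb{N}$, and recursively for $m,n\in\mathbb{N}$ $$d_{m,n}=\min_{z}\ \sum_{i=0}^m\sum_{j=0}^n z_{i,j}\,d_{i-1,j-1},$$ the minimum being over all arrays $z_{i,j}\ge0$ ($0\le i\le m$, $0\le j\le n$) with $\sum_{j}z_{i,j}=\pi^m_i$ for all $i$ and $\sum_i z_{i,j}=\pi^n_j$ for all $j$. The residual bound is $$R_n=R_n(\pi)=\sum_{i=0}^n\pi^n_i\,d_{i-1,n},$$ which depends only on $\pi^0,\ldots,\pi^n$. $\hat R_n$ denotes the value of $R_n$ for the optimal sequence $\hat\beta$. Optimization strategies. - Fixed horizon $(\mathrm{FH}_n)$: for given $n$, minimize $R_n(\pi)$ jointly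 over all of $\pi^1,\ldots,\pi^n$ (for Halpern: over $(\beta_1,\ldots,\beta_n)\in[0,1]^n$). - Sequential $(\mathrm{S}_n)$: for $n=1,2,\ldots$ successively, with $\pi^0,\ldots,\pi^{n-1}$ fixed as the solutions computed at the previous stages, minimize $R_n$ over $\pi^n$ only (for Halpern: over $\beta_n\in[0,1]$). - Monotone sequential $(\mathrm{MS}_n)$: for $n=1,2,\ldots$ successively, with $\pi^0,\ldots,\pi^{n-1}$ (hence $d_{i,j}$ for $i,j\le n-1$) fixed as the solutions of the previous stages, minimize $$\pi^n_0+\sum_{k=1}^n\pi^n_k\,D_{k-1,n}(\pi^n)$$ over $\pi^n$ subject to $\pi^n_k\le\pi^{n-1}_k$ for $k=0,\ldots,n-1$ and $\pi^n_n\ge\frac12$, where for $m<n$ $$D_{m,n}(\pi^n)=\sum_{i=0}^m(\pi^m_i-\pi^n_i)\,d_{i-1,n-1}+\sum_{j=m+1}^n\pi^n_j\,(d_{m-1,j-1}-d_{m-1,n-1}).$$ *)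

(* Defs.v *)
From HB Require Import structures.
From mathcomp Require Import all_boot all_order all_algebra.
From mathcomp Require Import all_classical all_reals all_analysis.

Set Implicit Arguments.
Unset Strict Implicit.
Unset Printing Implicit Defensive.

Import Order.TTheory GRing.Theory Num.Theory.
Import numFieldNormedType.Exports.

Local Open Scope classical_set_scope.
Local Open Scope ring_scope.

Section Bounds.
Variable R : realType.

(* Transport plans from p, seen on {0, ..., m}, to q, seen on {0, ..., n}. *)
Definition plans m n (p q : nat -> R) : set 'M[R]_(m.+1, n.+1) :=
  [set z | [/\ forall i j, 0 <= z i j,
               forall i : 'I_m.+1, \sum_j z i j = p i &
               forall j : 'I_n.+1, \sum_i z i j = q j]].

Arguments plans : clear implicits.

Definition plan_cost m n (c : nat -> nat -> R) (z : 'M[R]_(m.+1, n.+1)) : R :=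
  \sum_(i < m.+1) \sum_(j < n.+1) z i j * c i j.

(* For probability vectors the infimum is a minimum: see plans_neq0 and
   transport_min. *)
Definition transport m n (p q : nat -> R) (c : nat -> nat -> R) : R :=
  inf [set plan_cost c z | z in plans m n p q].

Arguments transport : clear implicits.

(* k is fuel: any k >= minn i j gives the same value, see dist_fuelE. *)
Fixpoint dist_fuel (k : nat) (pi : nat -> nat -> R) (i j : nat) : R :=
  match i, j with
  | 0, 0 => 0
  | 0, _.+1 | _.+1, 0 => 1
  | m.+1, n.+1 =>
      if k is k'.+1 then transport m n (pi m) (pi n) (dist_fuel k' pi) else 0
  end.

(* Indices are shifted by one, to start from 0 instead of -1:
   dist pi i j is d_{i-1,j-1}. The recursion is dist00, dist0S, distS0 and
   distSS. *)
Definition dist (pi : nat -> nat -> R) (i j : nat) : R := dist_fuel i pi i j.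

(* R_n(pi) = sum_{i=0}^n pi^n_i d_{i-1,n} *)
Definition residual (pi : nat -> nat -> R) (n : nat) : R :=
  \sum_(i < n.+1) pi n i * dist pi i n.+1.

(* D_{m,n}(pi^n), for m < n *)
Definition Dmono (pi : nat -> nat -> R) (m n : nat) : R :=
  \sum_(i < m.+1) (pi m i - pi n i) * dist pi i n +
  \sum_(m.+1 <= j < n.+1) pi n j * (dist pi m j - dist pi m n).

Definition mono_objective (pi : nat -> nat -> R) (n : nat) : R :=
  pi n 0 + \sum_(1 <= k < n.+1) pi n k * Dmono pi k.-1 n.

(* pi^n = (1 - beta_n) delta^0 + beta_n delta^n; for n = 0 this is delta^0
   whatever beta 0 is. *)
Definition halpern (beta : nat -> R) (n i : nat) : R :=
  (1 - beta n) * (i == 0)%:R + beta n * (i == n)%:R.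

Definition halpern_feasible (n : nat) (beta : nat -> R) : Prop :=
  0 <= beta n <= 1.

(* (beta_1, ..., beta_n) solves FH_n. *)
Definition FH_solution (n : nat) (beta : nat -> R) : Prop :=
  (forall k, (1 <= k <= n)%N -> halpern_feasible k beta) /\
  forall gamma : nat -> R,
    (forall k, (1 <= k <= n)%N -> halpern_feasible k gamma) ->
    residual (halpern beta) n <= residual (halpern gamma) n.

(* (beta_1, ..., beta_n) solves S_1, ..., S_n successively. *)
Definition S_solution (n : nat) (beta : nat -> R) : Prop :=
  forall k, (1 <= k <= n)%N ->
    halpern_feasible k beta /\
    forall b : R, let gamma := [eta beta with k |-> b] in
      halpern_feasible k gamma ->
      residual (halpern beta) k <= residual (halpern gamma) k.

Definition MS_feasible (n : nat) (beta : nat -> R) : Prop :=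
  [/\ halpern_feasible n beta,
      forall i, (i < n)%N -> halpern beta n i <= halpern beta n.-1 i &
      2^-1 <= halpern beta n n].

(* (beta_1, ..., beta_n) solves MS_1, ..., MS_n successively. *)
Definition MS_solution (n : nat) (beta : nat -> R) : Prop :=
  forall k, (1 <= k <= n)%N ->
    MS_feasible k beta /\
    forall b : R, let gamma := [eta beta with k |-> b] in
      MS_feasible k gamma ->
      mono_objective (halpern beta) k <= mono_objective (halpern gamma) k.

(* All strategies leave beta 0 free: only beta_1, ..., beta_n are compared. *)
Definition unique_solution (n : nat) (sol : (nat -> R) -> Prop)
    (bhat : nat -> R) : Prop :=
  forall beta, sol beta <-> forall k, (1 <= k <= n)%N -> beta k = bhat k.

Section Iteration.
Variable V : normedModType R.

Definition diameter (C : set V) : \bar R :=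
  ereal_sup [set (`|u.1 - u.2|)%:E | u in C `*` C].

Definition nonexpansive_on (C : set V) (T : V -> V) : Prop :=
  (forall u, C u -> C (T u)) /\
  (forall u v, C u -> C v -> `|T u - T v| <= `|u - v|).

Definition halpern_sequence (C : set V) (T : V -> V) (beta : nat -> R)
    (y0 : V) (x : nat -> V) : Prop :=
  [/\ C y0, C (x 0) &
      forall n, x n.+1 = (1 - beta n.+1) *: y0 + beta n.+1 *: T (x n)].

End Iteration.

Lemma eq_transport m n p q (c c' : nat -> nat -> R) :
  (forall i j, (i <= m)%N -> (j <= n)%N -> c i j = c' i j) ->
  transport m n p q c = transport m n p q c'.
Proof.
move=> cc'; congr inf; apply: eq_imagel => z _.
by apply: eq_bigr => i _; apply: eq_bigr => j _; rewrite cc' // -ltnS ltn_ord.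
Qed.

Lemma dist_fuelE k k' pi i j : (minn i j <= k)%N -> (minn i j <= k')%N ->
  dist_fuel k pi i j = dist_fuel k' pi i j.
Proof.
elim: k k' i j => [|k IH] [|k'] [|i] [|j] //=; rewrite minnSS ?ltnS // => ik ik'.
apply: eq_transport => a b ai bj.
have abij : (minn a b <= minn i j)%N.
  by rewrite leq_min !geq_min ai bj orbT.
by apply: IH; [exact: leq_trans ik | exact: leq_trans ik'].
Qed.

Lemma dist00 pi : dist pi 0 0 = 0. Proof. by []. Qed.

Lemma dist0S pi j : dist pi 0 j.+1 = 1. Proof. by []. Qed.

Lemma distS0 pi i : dist pi i.+1 0 = 1. Proof. by []. Qed.

Lemma distSS pi m n :
  dist pi m.+1 n.+1 = transport m n (pi m) (pi n) (dist pi).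
Proof.
apply: eq_transport => i j im _.
by apply: dist_fuelE; rewrite geq_min ?leqnn ?im.
Qed.

Lemma plans_neq0 m n (p q : nat -> R) :
  (forall i, 0 <= p i) -> \sum_(i < m.+1) p i = 1 ->
  (forall j, 0 <= q j) -> \sum_(j < n.+1) q j = 1 ->
  plans m n p q !=set0.
Proof.
move=> p0 p1 q0 q1; exists (\matrix_(i, j) (p i * q j)); split.
- by move=> i j; rewrite mxE mulr_ge0.
- by move=> i; under eq_bigr do rewrite mxE; rewrite -mulr_sumr q1 mulr1.
- by move=> j; under eq_bigr do rewrite mxE; rewrite -mulr_suml p1 mul1r.
Qed.

Lemma transport_min m n p q (c : nat -> nat -> R) :
  plans m n p q !=set0 ->
  exists2 z, plans m n p q z &
    transport m n p q c = plan_cost c z /\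
    forall z', plans m n p q z' -> plan_cost c z <= plan_cost c z'.
Proof.
move=> [z0 plan0]; pose N := (m.+1 * n.+1)%N.
pose A : set 'rV[R]_N := [set v | plans m n p q (vec_mx v)].
have cont_entry i j : continuous (fun v : 'rV[R]_N => vec_mx v i j : R).
  move=> v.
  rewrite (_ : (fun _ => _) = fun w : 'rV[R]_N => w 0 (mxvec_index i j)).
    exact: coord_continuous.
  by apply/funext => w; rewrite mxE.
have cont_sum (I : finType) (f : I -> 'rV[R]_N -> R) :
    (forall i, continuous (f i)) -> continuous (fun v => \sum_i f i v).
  move=> fc; apply: continuous_big => [|i _]; last exact: fc.
  exact: add_continuous.
have closed_ge0 i j : closed [set v : 'rV[R]_N | 0 <= vec_mx v i j].
  by apply: (@preimage_closed _ _ _ [set x : R | 0 <= x]) => [v _|];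
    [exact: cont_entry|exact: closed_ge].
have closed_fiber (f : 'rV[R]_N -> R) a :
    continuous f -> closed [set v | f v = a].
  move=> fc; apply: (@preimage_closed _ _ f [set x : R | x = a]) => [v _|];
    [exact: fc|exact: closed_eq].
have A_E : A = \bigcap_i \bigcap_j [set v | 0 <= vec_mx v i j] `&`
    (\bigcap_i [set v | \sum_j vec_mx v i j = p (i : 'I_m.+1)] `&`
     \bigcap_j [set v | \sum_i vec_mx v i j = q (j : 'I_n.+1)]).
  apply/seteqP; split => v; rewrite /A /plans /=.
    by move=> [v0 vp vq]; split; [|split] => i _ //= j _ /=; exact: v0.
  move=> [v0 [vp vq]]; split.
  - by move=> i j; exact: v0.
  - by move=> i; exact: vp.
  - by move=> j; exact: vq.
have closedA : closed A.
  rewrite A_E; apply: closedI; [|apply: closedI].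
  - by apply: closed_bigI => i _; apply: closed_bigI => j _.
  - by apply: closed_bigI => i _; apply: closed_fiber; exact: cont_sum.
  - by apply: closed_bigI => j _; apply: closed_fiber; exact: cont_sum.
have entry_le z i j : plans m n p q z -> z i j <= \sum_(i < m.+1) `|p i|.
  move=> [z_ge0 zp _]; apply: (@le_trans _ _ (p i)).
    by rewrite -zp (bigD1 j) //= lerDl sumr_ge0.
  apply: (le_trans (ler_norm _)).
  by rewrite (bigD1 i) //= lerDl sumr_ge0.
have bndA : bounded_set A.
  exists (\sum_(i < m.+1) `|p i|); split; first exact: num_real.
  move=> M /ltW pM v Av; apply: le_trans pM.
  rewrite /Num.norm/= mx_normrE; apply/bigmax_leP; split => /=.
    by apply: sumr_ge0 => i _; exact: normr_ge0.
  move=> [i0 k] _ /=; rewrite (ord1 i0).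
  case/mxvec_indexP: k => i j; rewrite -[v]vec_mxK mxvecE ger0_norm.
    exact: entry_le.
  by case: Av.
have cont_cost : continuous (fun v : 'rV[R]_N => plan_cost c (vec_mx v)).
  apply: (@cont_sum _ (fun i v => \sum_j vec_mx v i j * c i j)) => i.
  apply: (@cont_sum _ (fun j v => vec_mx v i j * c i j)) => j v.
  apply: (@cvgMr_tmp _ _ _ (nbhs_filter v)
    (fun w : 'rV[R]_N => vec_mx w i j)).
  exact: cont_entry.
have [|v Av vmin] := EVT_min_rV _ (bounded_closed_compact bndA closedA)
    (continuous_subspaceT cont_cost).
  by exists (mxvec z0); rewrite /A /= mxvecK.
have zmin z' : plans m n p q z' -> plan_cost c (vec_mx v) <= plan_cost c z'.
  move=> planz'; have := vmin (mxvec z'); rewrite mxvecK; apply.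
  by rewrite inE /A /= mxvecK.
have planv : plans m n p q (vec_mx v) by move: Av; rewrite inE.
exists (vec_mx v) => //; split => //.
apply/eqP; rewrite eq_le; apply/andP; split.
- apply: ge_inf; last by exists (vec_mx v).
  by exists (plan_cost c (vec_mx v)) => _ [z' planz' <-]; exact: zmin.
- apply: lb_le_inf => [|_ [z' planz' <-]]; last exact: zmin.
  by exists (plan_cost c z0), z0.
Qed.

End Bounds.

(* Main.v *)
Require Import Defs.
From HB Require Import structures.
From mathcomp Require Import all_boot all_order all_algebra ring lra.
From mathcomp Require Import all_classical all_reals all_analysis.

Set Implicit Arguments.
Unset Strict Implicit.
Unset Printing Implicit Defensive.

Import Order.TTheory GRing.Theory Num.Theory.
Import numFieldNormedType.Exports.

Local Open Scope classical_set_scope.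
Local Open Scope ring_scope.

(** Write [s_n] for the distance d_{n-1,n} and [r_n] for the residual bound.
    An optimal plan between two Halpern distributions keeps as much mass as
    possible both at 0 and on the pair of moving atoms, so that, with
    [beta_0 = 0] and [s_0 = 1],
      [s_{n+1} = |beta_{n+1} - beta_n| + min(beta_n, beta_{n+1}) * s_n] and
      [r_n = 1 - beta_n + beta_n * s_n]
    ([transport_halpern], [residual_halpern], [dist_halpernS]).
    If [beta_n <= beta_{n+1}], eliminating [s_n] and completing the square give
      [r_{n+1} = (beta_{n+1} - (1 - r_n / 2))^2 + (r_n - r_n^2 / 4)],
    and a decreasing step does no better than [beta_{n+1} = beta_n]. So
    [r_{n+1} >= r_n - r_n^2 / 4]; for [beta_n < 1], equality forces
    [beta_{n+1} = 1 - r_n / 2], and it holds there if the step is nondecreasing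
    ([residualS_min], [residualS_nondecreasing]). As [r - r^2 / 4] is strictly
    increasing on [0, 1], the greedy choice is also the unique minimizer over a
    fixed horizon ([opt_residual_le]), and the monotone objective is the right-hand side of
    the displayed equality ([mono_objective_halpern]). Thus the three strategies
    agree, with [rho_{n+1} = rho_n - rho_n^2 / 4], [rho_0 = 1] as bounds and
    [bhat_{n+1} = 1 - rho_n / 2] as coefficients.

    For tightness, the unit square with the sup norm suffices. Starting from
    y0 = x^0 = (1, 1), the iterates are (rho_n, 1 - bhat_n) and their images
    (0, rho_n / 2) for even n, with the two coordinates exchanged for odd n.
    The nonzero coordinate of the images alternates, so the coordinate that
    realizes |x^n - T x^n| = rho_n always compares with 0. The assignment of
    images to iterates is nonexpansive ([opt_image_lipschitz]), hence extends
    coordinatewise to the square ([lipschitz_extension]).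

    The bound [rho_n <= 4 / (n + 4)] is an induction, and the limit is a Cesaro
    mean: the increments of [1 / rho_n] are [1 / (4 - rho_n)], which tend to
    1/4. *)

(** * Transport between Halpern distributions *)

Section Transport.
Variable R : realType.
Implicit Types (p q phi psi beta : nat -> R) (c : nat -> nat -> R).

(** Potentials are tested on the supports of the marginals only: a plan puts
    no mass elsewhere. For two-point marginals this leaves at most four
    inequalities, whatever the cost is at the other points. *)
Lemma transport_weak_duality m n p q c phi psi (z : 'M[R]_(m.+1, n.+1)) :
  (forall i j, (i <= m)%N -> (j <= n)%N -> p i != 0 -> q j != 0 ->
    phi i + psi j <= c i j) ->
  plans p q z ->
  \sum_(i < m.+1) p i * phi i + \sum_(j < n.+1) q j * psi j <= plan_cost c z.
Proof.
move=> phipsi [z0 zp zq].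
have zsupp i j : z i j != 0 -> p i != 0 /\ q j != 0.
  move=> zij; have zij0 : 0 < z i j by rewrite lt_neqAle eq_sym zij z0.
  split; rewrite gt_eqF // (lt_le_trans zij0) //.
    by rewrite -zp (bigD1 j) //= lerDl sumr_ge0.
  by rewrite -zq (bigD1 i) //= lerDl sumr_ge0.
have -> : \sum_(i < m.+1) p i * phi i =
    \sum_(i < m.+1) \sum_(j < n.+1) z i j * phi i.
  by apply: eq_bigr => i _; rewrite -zp mulr_suml.
have -> : \sum_(j < n.+1) q j * psi j =
    \sum_(i < m.+1) \sum_(j < n.+1) z i j * psi j.
  by rewrite exchange_big; apply: eq_bigr => j _; rewrite -zq mulr_suml.
rewrite -big_split; apply: ler_sum => i _ /=.
rewrite -big_split; apply: ler_sum => j _ /=; rewrite -mulrDr.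
have [->|/zsupp[pi0 qj0]] := eqVneq (z i j) 0; first by rewrite !mul0r.
by rewrite ler_wpM2l // phipsi // -ltnS.
Qed.

(** A plan and a pair of potentials with equal values certify each other. *)
Lemma transport_strong_duality m n p q c phi psi (z : 'M[R]_(m.+1, n.+1)) :
  (forall i j, (i <= m)%N -> (j <= n)%N -> p i != 0 -> q j != 0 ->
    phi i + psi j <= c i j) ->
  plans p q z ->
  plan_cost c z = \sum_(i < m.+1) p i * phi i + \sum_(j < n.+1) q j * psi j ->
  transport m n p q c =
    \sum_(i < m.+1) p i * phi i + \sum_(j < n.+1) q j * psi j.
Proof.
move=> phipsi plan_z cost_z.
have [|z' plan_z' [-> z'min]] := @transport_min R m n p q c.
  by exists z.
apply/le_anti; rewrite (transport_weak_duality phipsi plan_z') andbT.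
by rewrite -cost_z z'min.
Qed.

Lemma sum_ord_pred1 n k (f : nat -> R) : (k <= n)%N ->
  \sum_(i < n.+1) (i == k :> nat)%:R * f i = f k.
Proof.
move=> kn; rewrite (bigD1 (inord k)) //= inordK // eqxx mul1r big1 ?addr0 //.
move=> i; rewrite -val_eqE /= inordK // => /negPf ->.
by rewrite mul0r.
Qed.

Lemma sum_halpern beta n (f : nat -> R) :
  \sum_(i < n.+1) halpern beta n i * f i = (1 - beta n) * f 0%N + beta n * f n.
Proof.
under eq_bigr do rewrite /halpern mulrDl -!mulrA.
by rewrite big_split /= -!mulr_sumr !sum_ord_pred1.
Qed.

Lemma halpern_supp beta n i : halpern beta n i != 0 -> i = 0%N \/ i = n.
Proof.
rewrite /halpern; case: (eqVneq i 0%N) => [->|_]; first by left.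
case: (eqVneq i n) => [->|_]; first by right.
by rewrite !mulr0 addr0 eqxx.
Qed.

(** At time 0 both atoms sit at 0, so the formulas that read [beta 0] as the mass
    of a separate atom are proved under [beta 0 = 0], and this lemma transfers
    them to an arbitrary [beta]. *)
Lemma halpern_reset0 beta : halpern beta = halpern [eta beta with 0%N |-> 0].
Proof.
apply/funext => n; apply/funext => i; rewrite /halpern /=.
case: (eqVneq n 0%N) => [->|//].
by rewrite /= subr0 -mulrDl subrK mul0r addr0.
Qed.

(** Matching the two moving atoms together costs at most 2, which is what
    matching each of them with the atom at 0 would cost; so an optimal plan
    matches as much of them as it can. *)
Lemma transport_halpern beta m n c :
  (0 < n)%N -> 0 <= beta m <= 1 -> 0 <= beta n <= 1 ->
  (m = 0%N -> beta m = 0) ->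
  c 0%N 0%N = 0 -> c 0%N n = 1 -> ((0 < m)%N -> c m 0%N = 1) -> c m n <= 2 ->
  transport m n (halpern beta m) (halpern beta n) c =
    `|beta n - beta m| + Num.min (beta m) (beta n) * c m n.
Proof.
move=> n0 /andP[a0 a1] /andP[b0 b1] m0 c00 c0n cm0 cmn.
set a := beta m in a0 a1 m0 *; set b := beta n in b0 b1 *.
pose t := Num.min a b.
(* The mass [t] goes from m to n; what remains of the larger moving atom is
   matched with 0. *)
pose w (i j : nat) : R := (1 - a - b + t) * ((i == 0%N)%:R * (j == 0%N)%:R)
  + (b - t) * ((i == 0%N)%:R * (j == n)%:R)
  + (a - t) * ((i == m)%:R * (j == 0%N)%:R)
  + t * ((i == m)%:R * (j == n)%:R).
have w_cost : plan_cost c (\matrix_(i < m.+1, j < n.+1) w i j) =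
    (1 - a - b + t) * c 0%N 0%N + (b - t) * c 0%N n + (a - t) * c m 0%N
    + t * c m n.
  have pt k l : (k <= m)%N -> (l <= n)%N ->
      \sum_(i < m.+1) \sum_(j < n.+1)
        ((i == k :> nat)%:R * (j == l :> nat)%:R) * c i j = c k l.
    move=> km ln; rewrite -(sum_ord_pred1 (c ^~ l) km); apply: eq_bigr => i _.
    rewrite -(sum_ord_pred1 (c i) ln) mulr_sumr.
    by apply: eq_bigr => j _; rewrite mulrA.
  rewrite -!pt // 4!mulr_sumr -!big_split; apply: eq_bigr => i _ /=.
  rewrite 4!mulr_sumr -!big_split; apply: eq_bigr => j _ /=.
  by rewrite mxE /w !mulrDl !mulrA.
have sum1 N k : (k <= N)%N -> \sum_(j < N.+1) (j == k :> nat)%:R = 1 :> R.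
  by move=> kN; rewrite -[RHS](sum_ord_pred1 (fun=> 1) kN);
     under [RHS]eq_bigr do rewrite mulr1.
have plan_w : plans (halpern beta m) (halpern beta n)
    (\matrix_(i < m.+1, j < n.+1) w i j).
  split.
  - move=> i j; rewrite mxE /w /t.
    case: (leP a b) => ab;
      by rewrite !addr_ge0 // mulr_ge0 ?mulr_ge0 ?ler0n //; lra.
  - move=> i; under eq_bigr do rewrite mxE /w.
    rewrite !big_split /= -!mulr_sumr !sum1 // /halpern -/a; ring.
  - move=> j; under eq_bigr do rewrite mxE /w.
    rewrite !big_split /= -!mulr_sumr -!mulr_suml !sum1 // /halpern -/b; ring.
(* The larger moving atom has potential 1, the atoms at 0 have potential 0, and
   tightness at (m, n) forces the fourth value. *)
pose phi i : R := if i == 0%N then 0 else if a <= b then c m n - 1 else 1.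
pose psi j : R := if j == 0%N then 0 else if a <= b then 1 else c m n - 1.
have n0' : (n == 0%N) = false by apply/negbTE; rewrite -lt0n.
rewrite (@transport_strong_duality _ _ _ _ _ phi psi _ _ plan_w).
- rewrite !sum_halpern -/a -/b /phi /psi eqxx n0' !mulr0 !add0r.
  case: (eqVneq m 0%N) => [/[dup] /m0 a_eq0 ->|_].
    rewrite a_eq0 mulr0 b0 add0r subr0 ger0_norm // min_l // mul0r addr0.
    by rewrite mulr1.
  case: leP => ab.
  + rewrite ger0_norm ?subr_ge0 //; ring.
  + rewrite ltr0_norm ?subr_lt0 //; ring.
- move=> i j _ _ /halpern_supp i_supp /halpern_supp j_supp.
  rewrite /phi /psi.
  have [i0|i0] := eqVneq i 0%N; have [j0|j0] := eqVneq j 0%N.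
  + by rewrite i0 j0 c00 addr0.
  + have -> : j = n by case: j_supp j0 => ->.
    by rewrite i0 c0n; case: ifP => _; lra.
  + have im : i = m by case: i_supp i0 => ->.
    have m_gt0 : (0 < m)%N by rewrite -im lt0n.
    by rewrite im j0 cm0 //; case: ifP => _; lra.
  + have -> : i = m by case: i_supp i0 => ->.
    have -> : j = n by case: j_supp j0 => ->.
    by case: ifP => _; lra.
- rewrite w_cost c00 c0n !sum_halpern -/a -/b /phi /psi eqxx n0' /t.
  case: (eqVneq m 0%N) => [mE|m_neq0].
    by rewrite mE c0n (m0 mE) b0 min_l //=; ring.
  rewrite cm0 ?lt0n //; case: leP => ab /=.
  + ring.
  + ring.
Qed.
End Transport.

(** * One step of the residual bound *)

Section Residual.
Variable R : realType.
Implicit Types beta : nat -> R.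

Lemma residual_halpern beta n : residual (halpern beta) n =
  1 - beta n + beta n * dist (halpern beta) n n.+1.
Proof.
rewrite /residual (sum_halpern beta n (fun i => dist (halpern beta) i n.+1)).
by rewrite dist0S mulr1.
Qed.

Lemma dist_halpernS beta n : beta 0%N = 0 ->
  halpern_feasible n beta -> halpern_feasible n.+1 beta ->
  dist (halpern beta) n n.+1 <= 2 ->
  dist (halpern beta) n.+1 n.+2 = `|beta n.+1 - beta n| +
    Num.min (beta n) (beta n.+1) * dist (halpern beta) n n.+1.
Proof.
move=> b0 fn fn1 d2; rewrite distSS transport_halpern //.
- by move=> ->.
- by case: n {fn fn1 d2}.
Qed.

Lemma dist_halpern_itv beta n : beta 0%N = 0 ->
  (forall k, (k <= n)%N -> halpern_feasible k beta) ->
  0 <= dist (halpern beta) n n.+1 <= 1.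
Proof.
move=> b0; elim: n => [|n IH] f; first by rewrite dist0S ler01 lexx.
have /andP[d0 d1] := IH (fun k kn => f k (leqW kn)).
have fn := f n (leqnSn n); have fn1 := f n.+1 (leqnn _).
rewrite dist_halpernS //; last by lra.
move/andP: fn => [a0 a1]; move/andP: fn1 => [c0 c1].
have ad0 := mulr_ge0 a0 d0; have ad1 := ler_piMr a0 d1.
have cd0 := mulr_ge0 c0 d0; have cd1 := ler_piMr c0 d1.
case: (leP (beta n) (beta n.+1)) => ab;
  [rewrite ger0_norm ?subr_ge0 //|rewrite ltr0_norm ?subr_lt0 //];
  lra.
Qed.

Lemma residual_itv beta n : beta 0%N = 0 ->
  (forall k, (k <= n)%N -> halpern_feasible k beta) ->
  0 <= residual (halpern beta) n <= 1.
Proof.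
move=> b0 f; have /andP[d0 d1] := dist_halpern_itv b0 f.
have /andP[a0 a1] := f n (leqnn _); rewrite residual_halpern.
by have ad0 := mulr_ge0 a0 d0; have ad1 := ler_piMr a0 d1; lra.
Qed.

(** On nondecreasing steps the new bound depends on the past through the previous
    bound only: [beta n] and the distance enter through
    [1 - beta n + beta n * dist (halpern beta) n n.+1]. *)
Lemma residualS_nondecreasing beta n : beta 0%N = 0 ->
  (forall k, (k <= n.+1)%N -> halpern_feasible k beta) ->
  beta n <= beta n.+1 ->
  let r := residual (halpern beta) n in
  residual (halpern beta) n.+1 =
    (beta n.+1 - (1 - r / 2)) ^+ 2 + (r - 4^-1 * r ^+ 2).
Proof.
move=> b0 f bS /=; rewrite !residual_halpern.
have /andP[d0 d1] := dist_halpern_itv b0 (fun k kn => f k (leqW kn)).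
have fn := f n (leqnSn n); have fn1 := f n.+1 (leqnn _).
rewrite dist_halpernS //; last by lra.
by rewrite ger0_norm ?subr_ge0 // min_l //; field.
Qed.

(** The sum of the first two terms is the bound obtained by repeating [beta n];
    the last term makes the loss strict as soon as [beta n < 1]. *)
Lemma residualS_decreasing beta n : beta 0%N = 0 ->
  (forall k, (k <= n.+1)%N -> halpern_feasible k beta) ->
  beta n.+1 < beta n ->
  let r := residual (halpern beta) n in
  (beta n - (1 - r / 2)) ^+ 2 + (r - 4^-1 * r ^+ 2) +
    (beta n - beta n.+1) * (1 - beta n) <= residual (halpern beta) n.+1.
Proof.
move=> b0 f bS /=; rewrite !residual_halpern.
have /andP[d0 d1] := dist_halpern_itv b0 (fun k kn => f k (leqW kn)).
have fn := f n (leqnSn n); have fn1 := f n.+1 (leqnn _).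
rewrite dist_halpernS //; last by lra.
move/andP: fn => [a0 a1]; move/andP: fn1 => [c0 c1].
rewrite ltr0_norm ?subr_lt0 // min_r; last exact: ltW.
set d := dist _ _ _ in d0 d1 *.
rewrite -subr_ge0 [leRHS](_ : _ =
  (beta n - beta n.+1) * (beta n + beta n.+1) * (1 - d)); last by field.
by rewrite !mulr_ge0 ?subr_ge0 ?addr_ge0 // ltW.
Qed.

(** The assumption [beta n < 1] excludes decreasing steps from the equality
    case. *)
Lemma residualS_min beta n : beta 0%N = 0 ->
  (forall k, (k <= n.+1)%N -> halpern_feasible k beta) ->
  let r := residual (halpern beta) n in
  r - 4^-1 * r ^+ 2 <= residual (halpern beta) n.+1 /\
  (beta n < 1 -> residual (halpern beta) n.+1 <= r - 4^-1 * r ^+ 2 ->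
   beta n.+1 = 1 - r / 2).
Proof.
move=> b0 f r.
have [bS|bS] := leP (beta n) (beta n.+1).
  rewrite (residualS_nondecreasing b0 f bS) -/r; split.
    by rewrite lerDr sqr_ge0.
  rewrite gerDr => _ sq0; apply/eqP.
  by rewrite -subr_eq0 -sqrf_eq0 eq_le sq0 sqr_ge0.
have := residualS_decreasing b0 f bS; rewrite -/r /= => rS.
have sq0 := sqr_ge0 (beta n - (1 - r / 2)).
have /andP[_ a1] := f n (leqnSn n).
have db0 : 0 <= (beta n - beta n.+1) * (1 - beta n).
  by rewrite mulr_ge0 ?subr_ge0 // ltW.
split=> [|lt1 rSle]; first lra.
have : 0 < (beta n - beta n.+1) * (1 - beta n) by rewrite mulr_gt0 ?subr_gt0.
lra.
Qed.

(** * The optimal coefficients *)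

Fixpoint opt_residual (n : nat) : R :=
  if n is m.+1 then opt_residual m - 4^-1 * opt_residual m ^+ 2 else 1.

Definition opt_coef (n : nat) : R :=
  if n is m.+1 then 1 - opt_residual m / 2 else 0.

Lemma opt_residual_itv n : 0 < opt_residual n <= 1.
Proof.
elim: n => [|n /andP[r0 r1]] /=; first by rewrite ltr01 lexx.
by apply/andP; split; nra.
Qed.

Lemma opt_coef_itv n : 0 <= opt_coef n < 1.
Proof.
case: n => [|n] /=; first by rewrite lexx ltr01.
by have /andP[r0 r1] := opt_residual_itv n; lra.
Qed.

Lemma opt_coefS n : opt_coef n.+1 = 2^-1 * (1 + opt_coef n ^+ 2).
Proof. by case: n => [|n] /=; field. Qed.

Lemma opt_coef_increasing : {homo opt_coef : m n / (m < n)%N >-> m < n}.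
Proof.
apply: homo_ltn => [|n]; first exact: lt_trans.
rewrite opt_coefS; have /andP[b0 b1] := opt_coef_itv n; nra.
Qed.

Lemma opt_coef_ge_half n : (0 < n)%N -> 2^-1 <= opt_coef n.
Proof.
case: n => [//|n] _ /=.
by have /andP[r0 r1] := opt_residual_itv n; lra.
Qed.

Lemma agree_reset0 beta n :
  (forall k, (1 <= k <= n)%N -> beta k = opt_coef k) ->
  forall k, (k <= n)%N -> [eta beta with 0%N |-> 0] k = opt_coef k.
Proof. by move=> eqb [|k] // kn; rewrite /= eqb. Qed.

Lemma feasible_reset0 beta n :
  (forall k, (1 <= k <= n)%N -> halpern_feasible k beta) ->
  forall k, (k <= n)%N -> halpern_feasible k [eta beta with 0%N |-> 0].
Proof.
move=> f [|k] kn; rewrite /halpern_feasible /=; first by rewrite lexx ler01.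
exact: f.
Qed.

(** The optimal coefficients increase, so every step is a nondecreasing one
    with a vanishing square. *)
Lemma residual_opt beta n :
  (forall k, (1 <= k <= n)%N -> beta k = opt_coef k) ->
  residual (halpern beta) n = opt_residual n.
Proof.
rewrite halpern_reset0 => /agree_reset0; move: [eta beta with _] => {}beta.
elim: n => [|n IH] eqb.
  by rewrite residual_halpern eqb // mul0r subr0 addr0.
have f k : (k <= n.+1)%N -> halpern_feasible k beta.
  move=> kn; rewrite /halpern_feasible eqb //.
  by have /andP[-> /ltW ->] := opt_coef_itv k.
have b0 : beta 0%N = 0 by rewrite eqb.
rewrite residualS_nondecreasing // ?eqb //.
  rewrite IH => [|k kn]; last by rewrite eqb // leqW.
  by rewrite /= subrr expr0n add0r.
by rewrite ltW // opt_coef_increasing.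
Qed.

(** Minimizing step by step is globally optimal because [r - r^2 / 4] is strictly
    increasing on [0, 1]: a better bound at one time can only help later, and
    equality at time n forces equality at all earlier times. *)
Lemma opt_residual_le beta n :
  (forall k, (1 <= k <= n)%N -> halpern_feasible k beta) ->
  opt_residual n <= residual (halpern beta) n /\
  (residual (halpern beta) n <= opt_residual n ->
   forall k, (1 <= k <= n)%N -> beta k = opt_coef k).
Proof.
move=> /feasible_reset0; rewrite halpern_reset0.
set gamma := [eta beta with _].
have betaE k : (0 < k)%N -> beta k = gamma k by case: k.
move=> f; suff [? agree] : opt_residual n <= residual (halpern gamma) n /\
    (residual (halpern gamma) n <= opt_residual n ->
     forall k, (k <= n)%N -> gamma k = opt_coef k).
  split=> // /agree {}agree k /andP[k0 kn]; rewrite betaE //; exact: agree.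
have b0 : gamma 0%N = 0 by [].
move: gamma b0 f {betaE} => gamma b0; elim: n => [|n IH] f.
  rewrite residual_halpern b0 mul0r subr0 addr0; split => // _ k.
  by rewrite leqn0 => /eqP ->.
have fn k : (k <= n)%N -> halpern_feasible k gamma.
  by move=> kn; apply: f; exact: leqW.
have [rge eqr] := IH fn.
have /andP[r0 r1] := residual_itv b0 fn.
have /andP[opt0 opt1] := opt_residual_itv n.
have [rSge eqrS] := residualS_min b0 f.
split=> [|rSle /=]; first by apply: le_trans rSge => /=; nra.
have rle : residual (halpern gamma) n <= opt_residual n.
  by have := le_trans rSge rSle => /=; nra.
have {}eqr := eqr rle.
have rE : residual (halpern gamma) n = opt_residual n by apply/le_anti/andP.
have gn1 : gamma n < 1 by rewrite eqr //; case/andP: (opt_coef_itv n).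
move=> k; rewrite leq_eqVlt ltnS => /orP[/eqP ->|]; last exact: eqr.
by rewrite eqrS // rE.
Qed.

(** For Halpern distributions the monotone objective is the exact bound of a
    nondecreasing step, extended to all values of [beta n.+1]. *)
Lemma mono_objective_halpern beta n :
  (forall k, (1 <= k <= n)%N -> beta k = opt_coef k) ->
  mono_objective (halpern beta) n.+1 =
    (beta n.+1 - opt_coef n.+1) ^+ 2 + opt_residual n.+1.
Proof.
move=> eqb; have := residual_opt eqb; move/agree_reset0: eqb.
have -> : beta n.+1 = [eta beta with 0%N |-> 0] n.+1 by [].
rewrite halpern_reset0; move: [eta beta with _] => {}beta eqb rE.
have b0 : beta 0%N = 0 by rewrite eqb.
rewrite /mono_objective big_nat_recr //= big_nat big1 ?add0r; last first.
  move=> i /andP[i0 iN]; rewrite /halpern.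
  by rewrite (gtn_eqF i0) (ltn_eqF iN) !mulr0 addr0 mul0r.
rewrite /Dmono big_nat1 subrr mulr0 addr0.
have -> : \sum_(i < n.+1) (halpern beta n i - halpern beta n.+1 i) *
    dist (halpern beta) i n.+1 = residual (halpern beta) n - (1 - beta n.+1).
  rewrite /residual; under eq_bigr do rewrite mulrBl.
  rewrite big_split /= sumrN; congr (_ - _).
  have -> : 1 - beta n.+1 = (1 - beta n.+1) * dist (halpern beta) 0 n.+1.
    by rewrite dist0S mulr1.
  rewrite -(sum_ord_pred1 (fun i => dist (halpern beta) i n.+1) (leq0n n)).
  rewrite mulr_sumr; apply: eq_bigr => i _; rewrite /halpern.
  by rewrite (ltn_eqF (ltn_ord i)) mulr0 addr0 mulrA.
rewrite rE /halpern !eqxx /=.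
by field.
Qed.

(** * The three optimization strategies *)

Lemma FH_opt n : unique_solution n (FH_solution n) opt_coef.
Proof.
move=> beta; split=> [[f betamin]|eqb].
  have [_ agree] := opt_residual_le f; apply: agree.
  rewrite -(@residual_opt opt_coef) //; apply: betamin => k _.
  by have /andP[b0 /ltW b1] := opt_coef_itv k; apply/andP.
split=> [k kn|gamma f].
  rewrite /halpern_feasible eqb //.
  by have /andP[-> /ltW ->] := opt_coef_itv k.
by rewrite residual_opt //; case: (opt_residual_le f).
Qed.

Lemma agree_at beta n b :
  (forall k, (1 <= k < n)%N -> beta k = opt_coef k) -> b = opt_coef n ->
  forall k, (1 <= k <= n)%N -> [eta beta with n |-> b] k = opt_coef k.
Proof.
move=> eqb bE k /andP[k0 kn] /=; case: (eqVneq k n) => [->//|k_neq_n].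
by rewrite eqb // k0 ltn_neqAle k_neq_n.
Qed.

Lemma sequential_agree beta n :
  (forall k, (1 <= k <= n)%N -> (forall i, (1 <= i < k)%N -> beta i = opt_coef i) ->
    beta k = opt_coef k) ->
  forall k, (1 <= k <= n)%N -> beta k = opt_coef k.
Proof.
move=> step; elim/ltn_ind=> k IH /andP[k0 kn]; apply: step => [|i /andP[i0 ik]].
  by rewrite k0.
by apply: IH => //; rewrite i0 (leq_trans (ltnW ik)).
Qed.

Lemma S_opt n : unique_solution n (S_solution n) opt_coef.
Proof.
move=> beta; split=> [sol|eqb k /andP[k0 kn]].
  apply: sequential_agree => k /[dup] kn /andP[k0 kn'] eqb.
  have f i : (1 <= i <= k)%N -> halpern_feasible i beta.
    by move=> /andP[i0 ik]; case: (sol i); rewrite ?i0 ?(leq_trans ik).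
  have [_ agree] := opt_residual_le f.
  apply: agree; last by rewrite k0 leqnn.
  have [_] := sol k kn; move/(_ (opt_coef k)); cbv zeta.
  rewrite (residual_opt (agree_at eqb erefl)) /halpern_feasible /= eqxx.
  by apply; have /andP[-> /ltW ->] := opt_coef_itv k.
have eqk i : (1 <= i <= k)%N -> beta i = opt_coef i.
  by move=> /andP[i0 ik]; rewrite eqb // i0 (leq_trans ik).
have f i : (1 <= i <= k)%N -> halpern_feasible i beta.
  move=> ik; rewrite /halpern_feasible eqk //.
  by have /andP[-> /ltW ->] := opt_coef_itv i.
split=> [|b gamma fb]; first by apply: f; rewrite k0 leqnn.
rewrite (residual_opt eqk).
have fg i : (1 <= i <= k)%N -> halpern_feasible i gamma.
  case: (eqVneq i k) => [->//|i_neq_k] /f; rewrite /halpern_feasible /=.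
  by rewrite (negPf i_neq_k).
by case: (opt_residual_le fg).
Qed.

Lemma MS_feasible_opt beta n :
  (forall k, (1 <= k <= n.+1)%N -> beta k = opt_coef k) -> MS_feasible n.+1 beta.
Proof.
move=> eqb; have bS : beta n.+1 = opt_coef n.+1 by rewrite eqb // leqnn.
have /andP[b0 b1] := opt_coef_itv n.+1.
split=> [|i iN|].
- by rewrite /halpern_feasible bS b0 ltW.
- rewrite /halpern (ltn_eqF iN) mulr0 addr0 /=.
  case: n => [|n] in eqb bS b0 b1 iN *.
    by move: iN; rewrite ltnS leqn0 => /eqP ->; rewrite eqxx !mulr1 bS; lra.
  have bn : beta n.+1 = opt_coef n.+1 by rewrite eqb //= leqnSn.
  rewrite bS bn -[leLHS]addr0 lerD //.
    by rewrite ler_wpM2r // lerD2l lerN2 ltW // opt_coef_increasing.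
  by rewrite mulr_ge0 //; case/andP: (opt_coef_itv n.+1).
- by rewrite /halpern eqxx mulr0 add0r mulr1 bS opt_coef_ge_half.
Qed.

Lemma MS_opt n : unique_solution n (MS_solution n) opt_coef.
Proof.
move=> beta; split=> [sol|eqb [//|k] kn].
  apply: sequential_agree => -[//|k] kn eqb.
  have [_] := sol k.+1 kn; move/(_ (opt_coef k.+1)); cbv zeta.
  set gamma := [eta beta with _ |-> _].
  have eqg : forall i, (1 <= i <= k.+1)%N -> gamma i = opt_coef i.
    exact: agree_at.
  move/(_ (MS_feasible_opt eqg)).
  rewrite (mono_objective_halpern eqb) mono_objective_halpern; last first.
    by move=> i /andP[i0 ik]; rewrite eqg // i0 leqW.
  rewrite [gamma _](_ : _ = opt_coef k.+1) /=; last by rewrite eqxx.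
  rewrite subrr expr0n /= lerD2r => sq0; apply/eqP.
  by rewrite -subr_eq0 -sqrf_eq0 eq_le sq0 sqr_ge0.
have eqk i : (1 <= i <= k.+1)%N -> beta i = opt_coef i.
  by move=> /andP[i0 ik]; rewrite eqb // i0 (leq_trans ik).
split=> [|b gamma _]; first exact: MS_feasible_opt.
have eqk' i : (1 <= i <= k)%N -> beta i = opt_coef i.
  by move=> /andP[i0 ik]; rewrite eqk // i0 leqW.
rewrite (mono_objective_halpern eqk') mono_objective_halpern; last first.
  move=> i /andP[i0 ik] /=; rewrite ltn_eqF ?ltnS //.
  by rewrite eqk' // i0.
by rewrite lerD2r eqk ?leqnn // subrr expr0n sqr_ge0.
Qed.

(** * Asymptotics of the optimal bounds *)

Lemma opt_residual_le4 n : opt_residual n <= 4 / (n + 4)%:R.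
Proof.
elim: n => [|n IH] /=; first by rewrite add0n divff.
have /andP[r0 r1] := opt_residual_itv n.
move: IH; rewrite addSn -[(n + 4).+1%:R]natr1 natrD.
have : 0 <= n%:R :> R by [].
move: (n%:R) (opt_residual n) r0 r1 => x r r0 r1 x0 IH.
have x4 : 0 < x + 4 by lra.
set u := 4 / (x + 4) in IH.
have u1 : u <= 1 by rewrite /u ler_pdivrMr //; lra.
(* With u = 4 / (n + 4) the claim becomes u - u^2 / 4 <= u / (1 + u / 4), whose
   two sides, multiplied by 1 + u / 4, differ by u^3 / 16. *)
have -> : 4 / (x + 4 + 1) = u / (1 + u / 4).
  rewrite /u; field; apply/andP; split; apply/eqP; lra.
have u0 : 0 < u by rewrite /u divr_gt0.
rewrite ler_pdivlMr; last by lra.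
apply: (@le_trans _ _ ((u - 4^-1 * u ^+ 2) * (1 + u / 4))).
  by rewrite ler_wpM2r; nra.
rewrite [leLHS](_ : _ = u - u ^+ 3 / 16); last by field.
by rewrite gerBl divr_ge0 // exprn_ge0 // ltW.
Qed.

Lemma inv_opt_residualS n :
  (opt_residual n.+1)^-1 - (opt_residual n)^-1 = (4 - opt_residual n)^-1.
Proof.
have /andP[r0 r1] /= := opt_residual_itv n; field.
by rewrite !gt_eqF //; nra.
Qed.

Lemma opt_residual_cvg0 : opt_residual @ \oo --> (0 : R).
Proof.
apply: (@squeeze_cvgr _ _ _ _ (fun=> 0) (fun n => 4 * harmonic n)).
- near=> n; have /andP[/ltW -> _] := opt_residual_itv n.
  apply: (le_trans (opt_residual_le4 n)).
  by rewrite ler_pM2l // lef_pV2 ?posrE // ler_nat -addn1 leq_add2l.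
- exact: cvg_cst.
- by rewrite -[0](mulr0 4); apply: cvgM; [exact: cvg_cst|exact: cvg_harmonic].
Unshelve. all: by end_near. Qed.

(** By Cesaro, the mean [1 / (n * rho_n)] of the increments of [1 / rho_n] tends
    to 1/4. *)
Lemma opt_residual_cvg4 :
  (fun n : nat => (n + 4)%:R * opt_residual n) @ \oo --> (4 : R).
Proof.
pose u n := (opt_residual n.+1)^-1 - (opt_residual n)^-1.
have ucvg : u @ \oo --> (4^-1 : R).
  rewrite (_ : u = fun n => (4 - opt_residual n)^-1); last first.
    by apply/funext => n; exact: inv_opt_residualS.
  apply: cvgV => //; rewrite -[X in _ --> X]subr0.
  by apply: cvgB; [exact: cvg_cst|exact: opt_residual_cvg0].
have seriesE n : series u n = (opt_residual n)^-1 - 1.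
  rewrite seriesEnat /= (telescope_sumr (fun k => (opt_residual k)^-1)) //.
  by rewrite invr1.
have := cesaro ucvg.
rewrite /arithmetic_mean /=; under eq_fun do rewrite seriesE; move=> meancvg.
have qcvg : (fun n => (n.+1%:R * opt_residual n.+1)^-1) @ \oo --> (4^-1 : R).
  rewrite -[X in _ --> X]addr0 (_ : (fun _ => _) = fun n =>
    n.+1%:R^-1 * ((opt_residual n.+1)^-1 - 1) + harmonic n).
    exact: cvgD meancvg (@cvg_harmonic R).
  apply/funext => n. by rewrite invfM /= mulrDr mulrN1 subrK.
have pcvg : (fun n => n%:R * opt_residual n) @ \oo --> (4 : R).
  by rewrite -cvg_shiftS; apply/cvgVP.
have -> : (fun n => (n + 4)%:R * opt_residual n) =
    (fun n => n%:R * opt_residual n + 4 * opt_residual n).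
  by apply/funext => n; rewrite natrD mulrDl.
have := cvgD pcvg (cvgM (@cvg_cst _ (4 : R) _ _ _) opt_residual_cvg0).
rewrite mulr0 addr0; apply.
Qed.

End Residual.

(** * Tightness *)

(** The McShane extension [sup_n (f n - |u - x n|)], cut off at 0 so that its values
    stay in [0, 1]. *)
Lemma lipschitz_extension (R : realType) (V : normedModType R) (x : nat -> V)
    (f : nat -> R) :
  (forall n, 0 <= f n <= 1) ->
  (forall i j, `|f i - f j| <= `|x i - x j|) ->
  exists F : V -> R, [/\ forall u, 0 <= F u <= 1,
    forall u v, `|F u - F v| <= `|u - v| & forall n, F (x n) = f n].
Proof.
move=> f01 f_lip.
pose h u n := Num.max 0 (f n - `|u - x n|).
have h_le u n : h u n <= 1.
  rewrite ge_max ler01 /= lerBlDr; have /andP[_ f1] := f01 n.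
  by rewrite (le_trans f1) // lerDl.
have h_sup u n : h u n <= sup (range (h u)).
  by apply: ub_le_sup; [exists 1 => _ [k _ <-]|exists n].
have sup_h u b : (forall n, h u n <= b) -> sup (range (h u)) <= b.
  move=> hb; apply: ge_sup => [|_ [n _ <-] //].
  by exists (h u 0%N), 0%N.
exists (fun u => sup (range (h u))); split=> [u|u v|n].
- rewrite sup_h // andbT (le_trans _ (h_sup u 0%N)) //.
  by rewrite le_max lexx.
- have half a b : sup (range (h a)) <= sup (range (h b)) + `|a - b|.
    apply: sup_h => n; rewrite ge_max.
    have := h_sup b n; rewrite ge_max => /andP[s0 sn].
    rewrite addr_ge0 //=.
    have := ler_distD a b (x n); rewrite [`|b - a|]distrC; lra.
  by rewrite ler_distlC lerBlDr half /= distrC half.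
- apply/le_anti/andP; split.
    apply: sup_h => k; have /andP[f0 _] := f01 n; rewrite ge_max f0 /=.
    rewrite lerBlDr -lerBlDl distrC; exact: le_trans (ler_norm _) (f_lip _ _).
  apply: le_trans (h_sup (x n) n).
  by rewrite /h subrr normr0 subr0 le_max lexx orbT.
Qed.

Section Tightness.
Variable R : realType.

Notation rho := (@opt_residual R).
Notation bhat := (@opt_coef R).

(** The roles of the two coordinates are exchanged at each step: an image that is
    nonzero in a coordinate is followed by one that vanishes there. *)
Definition parity_pair (n : nat) (a b : R) : R^o * R^o :=
  if odd n then (b, a) else (a, b).

Definition opt_iterate n := parity_pair n (rho n) (1 - bhat n).
Definition opt_image n := parity_pair n 0 (rho n / 2).

Lemma opt_residual_noninc : {homo rho : m n / (m <= n)%N >-> n <= m}.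
Proof.
apply: homo_leq => [//|x y z yx zy|n]; first exact: le_trans zy yx.
by rewrite /= gerBl mulr_ge0 // sqr_ge0.
Qed.

Lemma norm_parity_pair n a b : `|parity_pair n a b| = Num.max `|a| `|b|.
Proof. by rewrite /parity_pair; case: odd; rewrite prod_normE //= maxC. Qed.

Lemma opt_iterateS n : opt_iterate n.+1 =
  (1 - bhat n.+1) *: ((1, 1) : R^o * R^o) + bhat n.+1 *: opt_image n.
Proof.
rewrite /opt_iterate /opt_image /parity_pair /=.
by case: odd; congr (_, _); rewrite /= /GRing.scale /=; field.
Qed.

Lemma opt_iterate_residual n : `|opt_iterate n - opt_image n| = rho n.
Proof.
have /andP[r0 _] := opt_residual_itv R n.
have -> : opt_iterate n - opt_image n =
    parity_pair n (rho n) (1 - bhat n - rho n / 2).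
  by rewrite /opt_iterate /opt_image /parity_pair; case: odd;
    congr (_, _); rewrite /= subr0.
rewrite norm_parity_pair gtr0_norm // max_l // ler_norml.
case: n r0 => [|n] r0 /=; first lra.
have /andP[q0 q1] := opt_residual_itv R n.
apply/andP; split; nra.
Qed.

(** For opposite parities the coordinate in which the earlier iterate is [rho i]
    carries [1 - bhat j], that is half of [rho j.-1], in the later one. As
    [rho j.-1 <= rho i], the gap is at least [rho i / 2]. *)
Lemma opt_iterate_far i j : (i < j)%N -> odd i != odd j ->
  rho i / 2 <= `|opt_iterate i - opt_iterate j|.
Proof.
case: j => [//|j] ij; have := opt_residual_noninc (ij : (i <= j)%N).
have /andP[q0 q1] := opt_residual_itv R j => rji odd_ij.
have : rho i / 2 <= `|rho i - (1 - bhat j.+1)|.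
  by apply: le_trans (ler_norm _) => /=; lra.
move: odd_ij; rewrite /opt_iterate /parity_pair prod_normE le_max.
by case: (odd i); case: (odd j.+1) => //= _ ->; rewrite ?orbT.
Qed.

(** For equal parities the images differ by half of what the iterates differ by
    in the [rho] coordinate. For opposite parities the distance of the images is
    the larger of [rho i / 2] and [rho j / 2]. *)
Lemma opt_image_lipschitz i j :
  `|opt_image i - opt_image j| <= `|opt_iterate i - opt_iterate j|.
Proof.
wlog ij : i j / (i < j)%N => [wlog_lt|].
  have [/wlog_lt //|/wlog_lt|->] := ltngtP i j; last by rewrite !subrr.
  by rewrite distrC [leRHS]distrC.
have /andP[i0 i1] := opt_residual_itv R i.
have /andP[j0 j1] := opt_residual_itv R j.
have rji := opt_residual_noninc (ltnW ij).
have [odd_ij|odd_ij] := eqVneq (odd i) (odd j).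
  have -> : opt_image i - opt_image j = parity_pair i 0 ((rho i - rho j) / 2).
    rewrite /opt_image /parity_pair -odd_ij; case: odd;
      by congr (_, _) => /=; field.
  have -> : opt_iterate i - opt_iterate j =
      parity_pair i (rho i - rho j) (bhat j - bhat i).
    rewrite /opt_iterate /parity_pair -odd_ij; case: odd;
      by congr (_, _) => /=; ring.
  rewrite !norm_parity_pair normr0 max_r ?normr_ge0 // le_max.
  have d0 : 0 <= rho i - rho j by rewrite subr_ge0.
  rewrite [`|_ / 2|]ger0_norm ?divr_ge0 // (ger0_norm d0).
  by apply/orP; left; lra.
apply: le_trans (opt_iterate_far ij odd_ij).
have -> : opt_image i - opt_image j = parity_pair i (- (rho j / 2)) (rho i / 2).
  move: odd_ij; rewrite /opt_image /parity_pair.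
  by case: (odd i); case: (odd j) => // _; congr (_, _) => /=; ring.
rewrite norm_parity_pair normrN !ger0_norm; [|lra|lra].
by rewrite ge_max lexx andbT; lra.
Qed.

Definition unit_square : set (R^o * R^o) :=
  [set u | 0 <= u.1 <= 1 /\ 0 <= u.2 <= 1].

Lemma convex_unit_square : convex_set unit_square.
Proof.
move=> u v l; rewrite !inE => -[u1 u2] [v1 v2].
have [l0 l1] : 0 <= l%:num /\ l%:num <= 1 by [].
have -> : conv l u v = l%:num *: (u : R^o * R^o) + (1 - l%:num) *: (v : R^o * R^o).
  by [].
split; rewrite /= /GRing.scale /=; nra.
Qed.

Lemma diameter_unit_square : diameter unit_square = 1%:E.
Proof.
apply/le_anti/andP; split.
  apply: ge_ereal_sup => _ [[u v] [[u1 u2] [v1 v2]] <-].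
  rewrite lee_fin prod_normE ge_max !ler_norml /= in u1 u2 v1 v2 *.
  lra.
apply: ereal_sup_ubound; exists ((1, 1), (0, 0)).
  by split; split => /=; rewrite ?lexx ?ler01.
by rewrite /= prod_normE /= !subr0 !normr1 maxxx.
Qed.

Lemma opt_coef_tight :
  exists (V : normedModType R) (C : set V) (T : V -> V) (y0 : V) (x : nat -> V),
    [/\ convex_set C, diameter C = 1%:E, nonexpansive_on C T,
        halpern_sequence C T bhat y0 x &
        forall n : nat, `|x n - T (x n)| = rho n].
Proof.
have image_itv n : unit_square (opt_image n).
  have /andP[r0 r1] := opt_residual_itv R n.
  by rewrite /unit_square /opt_image /parity_pair; case: odd => /=; lra.
have norm1 (u : R^o * R^o) : `|u.1| <= `|u| by rewrite prod_normE le_max lexx.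
have norm2 (u : R^o * R^o) : `|u.2| <= `|u|.
  by rewrite prod_normE le_max lexx orbT.
have lip1 i j : `|(opt_image i).1 - (opt_image j).1| <=
    `|opt_iterate i - opt_iterate j|.
  exact: le_trans (norm1 _) (opt_image_lipschitz i j).
have lip2 i j : `|(opt_image i).2 - (opt_image j).2| <=
    `|opt_iterate i - opt_iterate j|.
  exact: le_trans (norm2 _) (opt_image_lipschitz i j).
have [F1 [F1_itv F1_lip F1E]] :=
  lipschitz_extension (fun n => (image_itv n).1) lip1.
have [F2 [F2_itv F2_lip F2E]] :=
  lipschitz_extension (fun n => (image_itv n).2) lip2.
pose T u : R^o * R^o := (F1 u, F2 u).
have TE n : T (opt_iterate n) = opt_image n.
  by rewrite /T F1E F2E -surjective_pairing.
exists (R^o * R^o)%type, unit_square, T, (1, 1), opt_iterate; split.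
- exact: convex_unit_square.
- exact: diameter_unit_square.
- split=> [u _|u v _ _]; first by split; [exact: F1_itv|exact: F2_itv].
  by rewrite prod_normE ge_max F1_lip F2_lip.
- split=> [||n].
  + by split; rewrite /= ler01 lexx.
  + by split; rewrite /opt_iterate /parity_pair /= ?subr0 ler01 lexx.
  + by rewrite TE opt_iterateS.
- by move=> n; rewrite TE opt_iterate_residual.
Qed.
End Tightness.

Theorem theorem4p1 (R : realType) :
  exists bhat : nat -> R, let Rhat := residual (halpern bhat) in
  [/\ forall n : nat,
        [/\ unique_solution n (FH_solution n) bhat,
            unique_solution n (S_solution n) bhat &
            unique_solution n (MS_solution n) bhat],
      bhat 0%N = 0 /\ (forall n : nat, bhat n.+1 = 2^-1 * (1 + bhat n ^+ 2)),
      {homo bhat : m n / (m < n)%N >-> m < n} /\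
      (forall n : nat, Rhat n.+1 = Rhat n - 4^-1 * Rhat n ^+ 2),
      exists (V : normedModType R) (C : set V) (T : V -> V) (y0 : V)
             (x : nat -> V),
        [/\ convex_set C, diameter C = 1%:E, nonexpansive_on C T,
            halpern_sequence C T bhat y0 x &
            forall n : nat, `|x n - T (x n)| = Rhat n] &
      (forall n : nat, Rhat n <= 4 / (n + 4)%:R) /\
      (fun n : nat => (n + 4)%:R * Rhat n) @ \oo --> (4 : R)].
Proof.
exists (@opt_coef R) => Rhat.
have -> : Rhat = @opt_residual R.
  by apply/funext => n; exact: residual_opt.
split.
- by move=> n; split; [exact: FH_opt|exact: S_opt|exact: MS_opt].
- by split=> // n; exact: opt_coefS.
- by split=> //; exact: opt_coef_increasing.
- exact: opt_coef_tight.
- by split; [exact: opt_residual_le4|exact: opt_residual_cvg4].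
Qed.
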